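(* Let $n>0$. For every finite $n$-dimensional simplicial complex $K$ equipped with a tiling $\mathcal{T}$, the sequence $\frac{1}{|h(\mathcal{T})|(n+1)!^d}h(\mathrm{Sd}^d(\mathcal{T}))$ converges to $h^n$ as $d$ grows to $+\infty$. Moreover, $h_0^n=h_{n+1}^n=0$ and $h^n$ is preserved by the symmetry $\rho_n$. Finally, $\frac{1}{(n+1)!^d}H_n^d$ converges to the matrix $(1,1,\ldots,1)(h^n)^t$, all of whose rows are equal to $h^n$, as $d$ grows to $+\infty$.
   Context: For $n>0$ and $s\in\{0,\ldots,n+1\}$, a tile of type $T_s^n$ is a closed $n$-simplex deprived of $s$ of its (closed) facets. A tiling $\mathcal{T}$ of an $n$-dimensional simplicial complex $K$ is a partition of $|K|$ into disjoint tiles, each of the form $\sigma$ deprived of $s$ of its facets for some $n$-simplex $\sigma$ of $K$. Its $h$-vector is $h(\mathcal{T})=(h_0(\mathcal{T}),\ldots,h_{n+1}(\mathcal{T}))$, $h_s(\mathcal{T})$ being the number of tiles of type $T_s^n$, and $|h(\mathcal{T})|=\sum_{s=0}^{n+1}h_s(\mathcal{T})$. Let $T_s^n=\Delta_n\setminus(\sigma_1\cup\cdots\cup\sigma_s)$, $\sigma_i$ facets of the standard simplex $\Delta_n$, and $\mathrm{Sd}(T_s^n)=\mathrm{Sd}(\Delta_n)\setminus\bigcup_{i=1}^s\mathrm{Sd}(\sigma_i)$, $\mathrm{Sd}$ being barycentric subdivision. A tiling of $\mathrm{Sd}(T_s^n)$ is a partition into tiles, each an $n$-simplex of $\mathrm{Sd}(\Delta_n)$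 deprived of some of its facets. $H_n$ is the $(n+2)\times(n+2)$ matrix whose $(s+1)$-st row, $s\in\{0,\ldots,n+1\}$, is the $h$-vector of a tiling of $\mathrm{Sd}(T_s^n)$ which contains exactly one tile $T_0^n$ if $s=0$ and none if $s>0$; such tilings exist and their $h$-vector does not depend on the choice. Equivalently, $H_0=\mathrm{Id}_2$ and, for $n\geq 0$ and $s\in\{1,\ldots,n+3\}$, the $s$-th row of $H_{n+1}$ is the sum of the first $s-1$ rows of $H_n$ each preceded by a $0$ and of the last $n+3-s$ rows of $H_n$ each followed by a $0$. $\mathrm{Sd}(\mathcal{T})$ is the tiling of $\mathrm{Sd}(K)$ obtained by subdividing each tile of $\mathcal{T}$ and tiling it by such a tiling of $\mathrm{Sd}(T_s^n)$, so that $h(\mathrm{Sd}(\mathcal{T}))=h(\mathcal{T})^tH_n$; $\mathrm{Sd}^d(\mathcal{T})$ is the $d$-fold iterate, a tiling of $\mathrm{Sd}^d(K)$. $h^n=(h_0^n,\ldots,h_{n+1}^n)$ is the eigenvector of the transposed matrix $H_n^t$ associated to the eigenvalue $(n+1)!$ (which is simple), normalized by $\sum_{s=0}^{n+1}h_s^n=1$. $\rho_n$ is the involution $(h_0,\ldots,h_{n+1})\mapsto(h_{n+1},\ldots,h_0)$ of $\mathbb{R}^{n+2}$. *)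

(* Defs.v *)
From HB Require Import structures.
From mathcomp Require Import all_boot all_order all_algebra.
From mathcomp Require Import all_classical all_reals all_analysis.

Set Implicit Arguments.
Unset Strict Implicit.
Unset Printing Implicit Defensive.

Import Order.TTheory GRing.Theory Num.Theory.
Import numFieldNormedType.Exports.

Local Open Scope ring_scope.

(* A finite simplicial complex is a set of non-empty vertex sets; the empty    *)
(* face is not a simplex.                                                      *)
Definition simplicial_complex (V : finType) (K : {set {set V}}) : Prop :=
  finset.set0 \notin K /\
  forall s t : {set V},
    s \in K -> t \subset s -> t != finset.set0 -> t \in K.

Definition has_dimension (V : finType) (n : nat) (K : {set {set V}}) : Prop :=
  (\max_(s in K) #|s|)%N = n.+1.

(* |K|, in barycentric coordinates. *)
Definition realization (R : realType) (V : finType) (K : {set {set V}}) :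
    set {ffun V -> R} :=
  [set x | [/\ forall v, 0 <= x v, \sum_v x v = 1 &
               finset (fun v => x v != 0) \in K]]%classic.
Arguments realization R {V} K.

Definition closed_simplex (V : finType) (s : {set V}) : {set {set V}} :=
  finset (fun t : {set V} => (t != finset.set0) && (t \subset s)).

Definition facets (V : finType) (s : {set V}) : {set {set V}} :=
  finset (fun t : {set V} => (t \subset s) && (#|t|.+1 == #|s|)).

(* A tile is encoded by a simplex and the set of those of its facets which are *)
(* removed. When n > 0 this encoding of the tiles as point sets is faithful    *)
(* (a point minus its empty facet would be the same point set as the point).   *)
Definition tile (V : finType) : finType := ({set V} * {set {set V}})%type.

Definition is_tile (V : finType) (n : nat) (K : {set {set V}}) (t : tile V) :
    Prop :=
  [/\ t.1 \in K, #|t.1| = n.+1 & t.2 \subset facets t.1].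

Definition tile_points (R : realType) (V : finType) (t : tile V) :
    set {ffun V -> R} :=
  (realization R (closed_simplex t.1) `\`
   \bigcup_(f in [set` t.2]) realization R (closed_simplex f))%classic.
Arguments tile_points R {V} t.

Definition tiling_of (R : realType) (V : finType) (n : nat) (K : {set {set V}})
    (X : set {ffun V -> R}) (T : {set tile V}) : Prop :=
  (forall t, t \in T -> is_tile n K t) /\
  classical_sets.partition [set` T]%classic (tile_points R) X.

Definition tiling (R : realType) (V : finType) (n : nat) (K : {set {set V}})
    (T : {set tile V}) : Prop :=
  tiling_of n K (realization R K) T.
Arguments tiling R {V} n K T.

Definition h_vector (R : realType) (V : finType) (n : nat) (T : {set tile V}) :
    'cV[R]_n.+2 :=
  \col_s #|finset (fun t => (t \in T) && (#|t.2| == s))|%:R.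
Arguments h_vector R {V} n T.

Definition h_total (R : realType) (V : finType) (n : nat) (T : {set tile V}) :
    R :=
  \sum_s h_vector R n T s 0.
Arguments h_total R {V} n T.

(* The vertices of Sd(K) are the simplices of K and its simplices are the      *)
(* non-empty sets of simplices of K totally ordered by inclusion.              *)
Definition Sd (V : finType) (K : {set {set V}}) : {set {set {set V}}} :=
  finset (fun c : {set {set V}} =>
    [&& c != finset.set0, c \subset K &
        [forall s in c, forall t in c, (s \subset t) || (t \subset s)]]).

Definition Sd_tile_points (R : realType) (V : finType) (t : tile V) :
    set {ffun {set V} -> R} :=
  (realization R (Sd (closed_simplex t.1)) `\`
   \bigcup_(f in [set` t.2]) realization R (Sd (closed_simplex f)))%classic.
Arguments Sd_tile_points R {V} t.

(* The tilings of the subdivided tile Sd(t) which contain exactly one tile of  *)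
(* type T_0 if t itself is of type T_0, and none otherwise.                    *)
Definition Sd_tile_tiling (R : realType) (V : finType) (n : nat) (t : tile V)
    (T : {set tile {set V}}) : Prop :=
  tiling_of n (Sd (closed_simplex t.1)) (Sd_tile_points R t) T /\
  h_vector R n T 0 0 = (#|t.2| == 0%N)%:R.
Arguments Sd_tile_tiling R {V} n t T.

(* T' is a tiling Sd(T): it is obtained by choosing such a tiling of the       *)
(* subdivision of each tile of T.                                              *)
Definition Sd_tiling (R : realType) (V : finType) (n : nat) (T : {set tile V})
    (T' : {set tile {set V}}) : Prop :=
  exists S : tile V -> {set tile {set V}},
    (forall t, t \in T -> Sd_tile_tiling R n t (S t)) /\
    T' = (\bigcup_(t in T) S t)%SET.
Arguments Sd_tiling R {V} n T T'.

(* The vertex type of the d-th barycentric subdivision. *)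
Fixpoint Sd_vertex (d : nat) (V : finType) : finType :=
  if d is d'.+1 then {set Sd_vertex d' V} : finType else V.

(* TT d is a tiling Sd^d(T), for each d. *)
Definition iterated_Sd_tiling (R : realType) (V : finType) (n : nat)
    (T : {set tile V}) (TT : forall d, {set tile (Sd_vertex d V)}) : Prop :=
  TT 0%N = T /\ forall d, Sd_tiling R n (TT d) (TT d.+1).
Arguments iterated_Sd_tiling R {V} n T TT.

Definition standard_tile (n s : nat) : tile 'I_n.+1 :=
  (finset.setT, finset (fun f : {set 'I_n.+1} =>
     [exists i : 'I_n.+1, (i < s)%N && (f == finset.setT :\ i)%SET])).

(* Row s is the h-vector of an arbitrarily chosen tiling of Sd(T_s^n) of the   *)
(* above kind; such tilings exist, so the default value is irrelevant.         *)
Definition H_mx (R : realType) (n : nat) : 'M[R]_n.+2 :=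
  \matrix_(s, j)
    h_vector R n
      (xget finset.set0 [set T | Sd_tile_tiling R n (standard_tile n s) T]%classic)
      j 0.

(* h^n; the eigenvalue (n+1)! of the transpose of H_mx is simple, so that      *)
(* there is exactly one such vector.                                           *)
Definition h_lim (R : realType) (n : nat) : 'cV[R]_n.+2 :=
  xget 0 [set h : 'cV[R]_n.+2 |
    (H_mx R n)^T *m h = (n.+1)`!%:R *: h /\ \sum_s h s 0 = 1]%classic.

Definition rho (R : realType) (n : nat) (h : 'cV[R]_n.+2) : 'cV[R]_n.+2 :=
  \col_s h (rev_ord s) 0.

(* Main.v *)
Require Import Defs.
From mathcomp Require Import all_boot all_fingroup zify.
Set Implicit Arguments.
Unset Strict Implicit.
Unset Printing Implicit Defensive.

(** Normalized by its row sums, the matrix H_n becomes a stochastic matrix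
    with a strictly positive column, so its powers converge geometrically to
    the matrix whose rows are its unique stationary distribution; the latter is
    h^n. The work lies in computing H_n, which is only given through arbitrarily
    chosen tilings.

    A tile is a union of relatively open faces, hence a tiling by points amounts
    to a partition of the non-empty faces ([tiling_of_face_tiling],
    [face_tiling_tiling_of]). A tile with s removed facets consists of the faces
    containing the s opposite vertices, so it has C(n+1-s, j-s) faces with j
    vertices. This array is unitriangular in (s, j): once the number of tiles of
    type 0 is prescribed, the numbers of faces of the tiled set determine the
    numbers of tiles of every type ([face_tiling_type_count]). Since the faces of
    a subdivided tile are the chains of subsets whose union contains the opposite
    vertices, their number depends only on s and n ([card_sd_faces]).

    It remains to exhibit one tiling of the subdivided standard tile. For a word w
    using each of the letters 0, ..., n once, the initial sets of w form a maximal
    chain, that is, an n-simplex of the subdivision. Append to w a sentinel lying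
    just below the letter s, and remove from this simplex the facets opposite to the
    initial sets at which the extended word ascends. A chain covering all letters
    smaller than s lies in the tile of the word spelled by its successive
    differences, each sorted decreasingly and the uncovered letters coming last, and
    in no other tile; the sentinel keeps the other chains out of all tiles
    ([flag_interval_exists], [flag_interval_uniq], [flag_interval_cover]). Hence
    the entry of H_n at (s, k) is the number of words with k ascents, sentinel
    included ([H_mxE]).

    All the needed properties of H_n are then visible on words. The rows sum to
    the number (n+1)! of words; complementing the letters exchanges ascents and
    descents, which gives the symmetry under simultaneous reversal of rows and
    columns, hence that of h^n; only the decreasing word with s = 0 has no
    ascent, so that h_0 = h_0 / (n+1)! for the stationary vector; and for n > 0
    and every s some word has exactly one ascent, so that column 1 is positive
    and multiplication by the normalized matrix contracts the l1 norm on vectors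
    of sum zero ([l1norm_contract]). Finally h(Sd^d(T)) is h(T)^t H_n^d, because
    the tiles of T keep distinct underlying simplices and an n-simplex of the
    subdivision lies in only one of those. *)

(** * Permutations sorting a family of keys *)

Lemma card_ltn_ord (m : nat) (i : 'I_m) : #|[set j : 'I_m | j < i]| = i.
Proof.
rewrite -sum1_card (eq_bigl (fun j : 'I_m => j < i)) => [|j]; last by rewrite inE.
by rewrite (big_ord_narrow (ltnW (ltn_ord i))) sum1_card card_ord.
Qed.

(** The permutation is the inverse of the rank, the rank of x being the number
    of indices with a smaller key. *)
Lemma sorting_perm (m : nat) (f : 'I_m -> nat) : injective f ->
  exists w : 'S_m, forall i j : 'I_m, i < j -> f (w i) < f (w j).
Proof.
move=> f_inj.
pose below x := [set y | f y < f x].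
have lt_rank x y : f x < f y -> #|below x| < #|below y|.
  move=> xy; apply: proper_card; apply/properP; split.
    by apply/subsetP=> z; rewrite !inE => /ltn_trans; apply.
  by exists x; rewrite !inE // ltnn.
have rank_lt x : #|below x| < m.
  rewrite -[X in _ < X]card_ord -cardsT; apply: proper_card.
  by apply/properP; split; [exact: subsetT | exists x; rewrite !inE ?ltnn].
have rank_inj : injective (fun x => Ordinal (rank_lt x)).
  move=> x y [] e; apply: f_inj.
  by case: (ltngtP (f x) (f y)) => // /lt_rank; rewrite e ltnn.
exists (perm rank_inj)^-1%g => i j ij; rewrite ltnNge; apply/negP => le_ji.
have rankK k : #|below ((perm rank_inj)^-1%g k)| = k.
  by rewrite -[RHS](congr1 val (permKV (perm rank_inj) k)) permE.
have : #|below ((perm rank_inj)^-1%g j)| <= #|below ((perm rank_inj)^-1%g i)|.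
  by apply/subset_leq_card/subsetP=> z; rewrite !inE => /leq_trans; apply.
by rewrite !rankK leqNgt ij.
Qed.

(** A sorting permutation puts at position i the element having i elements with
    smaller keys. *)
Lemma sorting_perm_uniq (m : nat) (f : 'I_m -> nat) (w w' : 'S_m) :
    (forall i j : 'I_m, i < j -> f (w i) < f (w j)) ->
    (forall i j : 'I_m, i < j -> f (w' i) < f (w' j)) ->
  w = w'.
Proof.
have rank_sorted (v : 'S_m) : (forall i j : 'I_m, i < j -> f (v i) < f (v j)) ->
    forall i, #|[set y | f y < f (v i)]| = i.
  move=> v_sorted i; rewrite -[RHS]card_ltn_ord -[RHS](card_imset _ (@perm_inj _ v)).
  apply: eq_card => y; have [j ->] : exists j, y = v j.
    by exists (v^-1%g y); rewrite permKV.
  rewrite mem_imset ?inE; last exact: perm_inj.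
  apply/idP/idP => [|/v_sorted//].
  by case: (ltngtP i j) => // [/v_sorted ij /(ltn_trans ij)|/val_inj ->]; rewrite ltnn.
move=> hw hw'; apply/permP=> i.
have [j wij] : exists j, w i = w' j by exists (w'^-1%g (w i)); rewrite permKV.
rewrite wij; congr (w' _); apply: val_inj.
by rewrite /= -(rank_sorted _ hw' j) -wij rank_sorted.
Qed.

(** * Words, flags and their ascents *)

(** The letters of w at positions 0, ..., i; they are read off the inverse of w,
    so that membership is a comparison of positions. *)
Definition initial_set (n : nat) (w : 'S_n.+1) (i : 'I_n.+1) : {set 'I_n.+1} :=
  [set x | (w^-1%g x <= i)%N].

Definition flag (n : nat) (w : 'S_n.+1) : {set {set 'I_n.+1}} :=
  [set initial_set w i | i : 'I_n.+1].

(** Positions i at which w ascends, w being followed by a sentinel smaller than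
    the letter s and larger than the letter s - 1: the last position is an ascent
    exactly when the last letter is less than s. *)
Definition ascents (n s : nat) (w : 'S_n.+1) : {set 'I_n.+1} :=
  [set i : 'I_n.+1 | if i == n :> nat then w i < s else w i < w (inord i.+1)].

Definition is_chain (V : finType) (c : {set {set V}}) :=
  [forall A in c, forall B in c, (A \subset B) || (B \subset A)].

(** The chains refined by the flag of w and containing all its initial sets that
    end at an ascent: the relatively open faces of the tile attached to w. *)
Definition flag_interval (n s : nat) (w : 'S_n.+1) (c : {set {set 'I_n.+1}}) :=
  ([set initial_set w i | i in ascents s w] \subset c) && (c \subset flag w).

Lemma mem_initial_set n (w : 'S_n.+1) (i j : 'I_n.+1) :
  (w j \in initial_set w i) = (j <= i).
Proof. by rewrite inE permK. Qed.

Lemma initial_set_inj n (w : 'S_n.+1) : injective (initial_set w).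
Proof.
move=> i j e; apply/val_inj/anti_leq/andP.
by rewrite -!(mem_initial_set w) -e mem_initial_set {1}e mem_initial_set.
Qed.

Lemma flag_chain n (w : 'S_n.+1) (c : {set {set 'I_n.+1}}) :
  c \subset flag w -> is_chain c.
Proof.
move=> /subsetP cw; apply/forall_inP => A /cw /imsetP[i _ ->].
apply/forall_inP => B /cw /imsetP[j _ ->].
have sub (k l : 'I_n.+1) : k <= l -> initial_set w k \subset initial_set w l.
  by move=> kl; apply/subsetP => x; rewrite !inE => /leq_trans; apply.
by case/orP: (leq_total i j) => /sub ->; rewrite ?orbT.
Qed.

Lemma flag_no_set0 n (w : 'S_n.+1) (c : {set {set 'I_n.+1}}) :
  c \subset flag w -> set0 \notin c.
Proof.
move=> /subsetP cw; apply/negP => /cw /imsetP[i _] /setP /(_ (w i)).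
by rewrite mem_initial_set leqnn inE.
Qed.

Lemma card_flag n (w : 'S_n.+1) : #|flag w| = n.+1.
Proof. by rewrite card_imset ?card_ord //; exact: initial_set_inj. Qed.

(** If w does not ascend right after a letter x < s, then the next letter is again
    less than s, so the argument goes on until an ascent, which the sentinel forces
    at the latest at the end of w. The initial set ending there belongs to c. *)
Lemma flag_interval_cover n s (w : 'S_n.+1) c (x : 'I_n.+1) :
  flag_interval s w c -> x < s -> x \in cover c.
Proof.
move=> /andP[/subsetP asc /subsetP cw].
have [i ->] : exists i, x = w i by exists (w^-1%g x); rewrite permKV.
have [k] := ubnP (n - i); elim: k i => // k IHk i ki xs.
have [/asc ic|] := boolP (initial_set w i \in [set initial_set w i | i in ascents s w]).
  by apply/bigcupP; exists (initial_set w i); rewrite ?mem_initial_set.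
rewrite mem_imset ?inE; last exact: initial_set_inj.
have [|ni] := eqVneq (i : nat) n; first by rewrite xs.
have lt_in : i.+1 < n.+1 by rewrite ltnS ltn_neqAle ni -ltnS ltn_ord.
rewrite -leqNgt => le_w; have := IHk (inord i.+1).
have kn : n - i.+1 < k by lia.
rewrite inordK // => /(_ kn (leq_ltn_trans le_w xs)) /bigcupP[A Ac].
have /cw /imsetP[j _ eA] := Ac.
rewrite eA mem_initial_set inordK // => ij.
by apply/bigcupP; exists A; rewrite // eA mem_initial_set ltnW.
Qed.

(** The rank of the block of the chain c containing x, a block being a difference
    of two consecutive members of c; the letters outside the union of c form the
    last block. *)
Definition block (n : nat) (c : {set {set 'I_n.+1}}) (x : 'I_n.+1) : nat :=
  #|[set A in c | x \notin A]|.

(** Encodes as one number the lexicographic order by block, then by decreasing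
    letter: the term n - x never reaches the weight n + 1 of the block. *)
Definition sort_key (n : nat) (c : {set {set 'I_n.+1}}) (x : 'I_n.+1) : nat :=
  block c x * n.+1 + (n - x).

Lemma sort_keyP n (c : {set {set 'I_n.+1}}) (x y : 'I_n.+1) :
  (sort_key c x < sort_key c y) =
  (block c x < block c y) || (block c x == block c y) && (y < x).
Proof.
rewrite /sort_key; move: (block c x) (block c y) (ltn_ord x) (ltn_ord y).
move: {x y}(nat_of_ord x) (nat_of_ord y) => x y a b xn yn.
have [ab|ba|->] := ltngtP a b => /=.
- by have := leq_mul2r n.+1 a.+1 b; rewrite ab mulSn; lia.
- by have := leq_mul2r n.+1 b.+1 a; rewrite ba mulSn; lia.
- by rewrite ltn_add2l; lia.
Qed.

Lemma sort_key_inj n (c : {set {set 'I_n.+1}}) : injective (sort_key c).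
Proof.
move=> x y e; apply/val_inj/eqP/negPn/negP => /= nxy.
have := sort_keyP c x y; have := sort_keyP c y x; rewrite e ltnn; lia.
Qed.

Lemma block_lt n (c : {set {set 'I_n.+1}}) (x y : 'I_n.+1) (A : {set 'I_n.+1}) :
    is_chain c -> A \in c -> x \in A -> y \notin A -> 
  block c x < block c y.
Proof.
move=> ch Ac xA yA; apply/proper_card/properP; split; last first.
  by exists A; rewrite inE Ac ?xA.
apply/subsetP => B; rewrite !inE => /andP[Bc xB]; rewrite Bc /=.
have /orP[/subsetP AB|/subsetP BA] := forall_inP (forall_inP ch _ Ac) _ Bc.
  by rewrite AB in xB.
by apply: contra yA; apply: BA.
Qed.

(** Between consecutive positions: if the initial set ending at the first one is
    in c, then a new block begins there; otherwise this position is not an ascent,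
    so the letter decreases while the block stays the same. *)
Lemma flag_interval_sorted n s (w : 'S_n.+1) c (i j : 'I_n.+1) :
  flag_interval s w c -> i < j -> sort_key c (w i) < sort_key c (w j).
Proof.
move=> /andP[/subsetP asc cw].
have step (k : nat) : k.+1 < n.+1 ->
    sort_key c (w (inord k)) < sort_key c (w (inord k.+1)).
  move=> kn; set i' := inord k; set j' := inord k.+1.
  have ik : i' = k :> nat by rewrite inordK // ltnW.
  have jk : j' = k.+1 :> nat by rewrite inordK.
  rewrite sort_keyP.
  have [ic|ic] := boolP (initial_set w i' \in c).
    apply/orP; left; apply: (block_lt (flag_chain cw) ic); rewrite mem_initial_set //.
    by rewrite ik jk ltnn.
  have : i' \notin ascents s w.
    by apply: contra ic => ia; apply/asc/imset_f.
  rewrite inE ik ltn_eqF // -leqNgt leq_eqVlt => /orP[/eqP/val_inj/perm_inj|lt_w].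
    by move/(congr1 (@nat_of_ord _)); rewrite ik jk => /esym/n_Sn.
  have -> : block c (w i') = block c (w j'); last by rewrite eqxx lt_w orbT.
  apply: eq_card => A; rewrite !inE; case Ac: (A \in c) => //=.
  have /imsetP[l _ eA] := subsetP cw _ Ac.
  rewrite eA !mem_initial_set ik jk; congr (~~ _).
  have : k != l.
    apply: contraNneq ic => kl; rewrite (_ : i' = l) -?eA //.
    by apply: val_inj; rewrite /= ik.
  by rewrite ltn_neqAle => ->.
have iter_step k d : k + d.+1 < n.+1 ->
    sort_key c (w (inord k)) < sort_key c (w (inord (k + d.+1))).
  elim: d => [|d IHd] kd; first by rewrite addn1; apply: step; lia.
  by rewrite addnS; apply: ltn_trans (IHd _) (step _ _); lia.
move=> ij; have := iter_step i (j - i.+1).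
by rewrite addnS -addSn subnKC // !inord_val; apply.
Qed.

Lemma flag_interval_uniq n s (w w' : 'S_n.+1) c :
  flag_interval s w c -> flag_interval s w' c -> w = w'.
Proof.
move=> wc wc'; apply: (@sorting_perm_uniq _ (sort_key c)) => i j.
  exact: flag_interval_sorted wc.
exact: flag_interval_sorted wc'.
Qed.

(** Sort the letters by [sort_key]. The members of c are then initial sets of w,
    and w can ascend only where a new block begins. The covering hypothesis is what
    handles the sentinel: if the last letter is less than s, then a member of c
    contains it and hence all letters. *)
Lemma flag_interval_exists n s (c : {set {set 'I_n.+1}}) :
    is_chain c -> set0 \notin c -> (forall x : 'I_n.+1, x < s -> x \in cover c) ->
  exists w : 'S_n.+1, flag_interval s w c.
Proof.
move=> ch c0 cov; have [w w_sorted] := sorting_perm (@sort_key_inj n c).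
have block_le (i j : 'I_n.+1) : i <= j -> block c (w i) <= block c (w j).
  rewrite leq_eqVlt => /orP[/eqP/val_inj->//|/w_sorted]; rewrite sort_keyP; lia.
have c_initial A k : A \in c -> w k \in A ->
    (forall j : 'I_n.+1, k < j -> w j \notin A) -> A = initial_set w k.
  move=> Ac kA kmax; apply/setP => x.
  have [i ->] : exists i, x = w i by exists (w^-1%g x); rewrite permKV.
  rewrite mem_initial_set; case: leqP => [ik|/kmax/negPf//].
  apply/negPn/negP => iA; have := block_le _ _ ik.
  by rewrite leqNgt (block_lt ch Ac kA iA).
have c_flag A : A \in c -> exists2 k, w k \in A & A = initial_set w k.
  move=> Ac; have [x xA] : exists x, x \in A.
    by apply/set0Pn; apply: contraNneq c0 => <-.
  have : w (w^-1%g x) \in A by rewrite permKV.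
  case/(@arg_maxnP _ _ (fun i => w i \in A) (@nat_of_ord _)) => k kA kmax.
  exists k => //; apply: (c_initial A k Ac kA) => j kj.
  by apply: contraL kj => /kmax; rewrite -leqNgt.
exists w; apply/andP; split; last first.
  by apply/subsetP => A /c_flag[k _ ->]; apply: imset_f.
apply/subsetP => _ /imsetP[i asc_i ->].
suff [A Ac [iA imax]] : exists2 A, A \in c & w i \in A /\
    (forall j : 'I_n.+1, i < j -> w j \notin A).
  by rewrite -(c_initial A i Ac iA imax).
move: asc_i; rewrite inE; have [ei ws|ni asc_i] := eqVneq (i : nat) n.
  have /bigcupP[A Ac iA] := cov _ ws; exists A => //; split=> // j.
  by rewrite ei ltnNge -ltnS ltn_ord.
have lt_in : i.+1 < n.+1 by rewrite ltnS ltn_neqAle ni -ltnS ltn_ord.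
have : sort_key c (w i) < sort_key c (w (inord i.+1)) by apply: w_sorted; rewrite inordK.
rewrite sort_keyP [_ < w i]ltnNge (ltnW asc_i) andbF orbF => lt_block.
have : ~~ ([set A in c | w (inord i.+1) \notin A] \subset [set A in c | w i \notin A]).
  by apply: contraL lt_block => /subset_leq_card; rewrite -leqNgt.
case/subsetPn => A; rewrite !inE => /andP[Ac jA]; rewrite Ac negbK => iA.
exists A => //; split=> // j ij; apply/negP => jA'.
have := block_lt ch Ac jA' jA.
by rewrite ltnNge block_le // inordK.
Qed.

Definition ascent_count (n s k : nat) : nat :=
  #|[set w : 'S_n.+1 | #|ascents s w| == k]|.

Lemma sum_ascent_count n s : \sum_(k < n.+2) ascent_count n s k = n.+1`!.
Proof.
have asc_le (w : 'S_n.+1) : #|ascents s w| < n.+2.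
  by rewrite ltnS -[X in _ <= X]card_ord max_card.
rewrite -(card_Sn n.+1) -sum1_card.
rewrite (partition_big (fun w => Ordinal (asc_le w)) xpredT) //=.
by apply: eq_bigr => k _; rewrite /ascent_count -sum1_card;
  apply: eq_bigl => w; rewrite inE.
Qed.

(** A word without ascent corresponds to a tile containing the empty chain, and the
    empty chain covers the letters less than s only if s = 0. *)
Lemma ascent_count0 n s : ascent_count n s 0 = (s == 0).
Proof.
have -> : ascent_count n s 0 = #|[set w : 'S_n.+1 | flag_interval s w set0]|.
  apply: eq_card => w; rewrite !inE /flag_interval sub0set andbT subset0.
  by rewrite -cards_eq0 card_imset //; exact: initial_set_inj.
have [->|s0] := posnP s; last first.
  apply/eqP; rewrite cards_eq0; apply/eqP/setP => w; rewrite !inE.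
  apply/negP => /(@flag_interval_cover _ _ _ _ ord0)/(_ s0).
  by rewrite /cover big_set0 inE.
have [|||w hw] := @flag_interval_exists n 0 set0; rewrite ?inE //.
  by apply/forall_inP => A; rewrite inE.
apply/eqP/cards1P; exists w; apply/setP => v; rewrite !inE.
by apply/idP/eqP => [/flag_interval_uniq|->//]; apply.
Qed.

(** Complementing the letters turns the ascents into descents, and the sentinel
    just below s into one just below n + 1 - s. *)
Lemma ascent_count_sym n s k : s <= n.+1 -> k <= n.+1 ->
  ascent_count n (n.+1 - s) (n.+1 - k) = ascent_count n s k.
Proof.
move=> sn kn; pose rev_word (w : 'S_n.+1) := (w * perm (@rev_ord_inj n.+1))%g.
have rev_wordE w i : rev_word w i = rev_ord (w i) by rewrite permM permE.
have rev_wordK : involutive rev_word.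
  by move=> w; apply/permP => i; rewrite !rev_wordE rev_ordK.
rewrite /ascent_count -[RHS](card_imset _ (inv_inj rev_wordK)).
apply: eq_card => w; rewrite -[w in RHS]rev_wordK mem_imset ?inE; last exact: inv_inj.
have -> : ascents s (rev_word w) = ~: ascents (n.+1 - s) w.
  apply/setP => i; rewrite !inE !rev_wordE /=.
  case: eqVneq => [_|ni]; first by have := ltn_ord (w i); lia.
  rewrite -leqNgt.
  have : w (inord i.+1) != w i :> nat.
    apply: contra_neq ni => /val_inj/perm_inj/(congr1 (@nat_of_ord _)).
    have [in'|] := ltnP i n; last by have := ltn_ord i; lia.
    by rewrite inordK //; lia.
  by have := ltn_ord (w i); have := ltn_ord (w (inord i.+1)); lia.
have := cardsC (ascents (n.+1 - s) w); rewrite card_ord; lia.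
Qed.

(** For s > 0 the decreasing word ascends only to the sentinel. For s = 0 the
    sentinel is below all letters, and exchanging the first two letters of the
    decreasing word creates a single ascent; this is where n > 0 is used. *)
Lemma ascent_count1_gt0 n s : 0 < n -> 0 < ascent_count n s 1.
Proof.
move=> n0; apply/card_gt0P.
pose r := perm (@rev_ord_inj n.+1).
have [s0|s0] := posnP s; last first.
  exists r; rewrite inE; apply/cards1P; exists ord_max; apply/setP => i.
  rewrite !inE !permE /= -val_eqE /=; case: eqVneq => [->|ni]; first by rewrite subnn.
  have in' : i < n by have := ltn_ord i; lia.
  by rewrite inordK ; lia.
(* The word n-1, n, n-2, ..., 0. *)
exists (tperm ord0 (inord 1) * r)%g; rewrite inE.
apply/cards1P; exists ord0; apply/setP => i.
rewrite !inE !permM !permE /= s0 ltn0.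
have [ei|ni] := eqVneq (i : nat) n; first by rewrite -val_eqE /= ei; lia.
have in' : i < n by have := ltn_ord i; lia.
have valE (k : nat) : k < n.+1 -> @inord n k = k :> nat by exact: inordK.
rewrite -!val_eqE /= !valE ?ltnS //.
case: ifP => i0; case: ifP => i1; rewrite ?valE ?ltnS //; try lia.
  by rewrite /=; lia.
all: by rewrite /= eqSS i0 valE ?ltnS //=; lia.
Qed.

(** * Faces of tiles *)

Definition regular_tile (V : finType) (n : nat) (t : tile V) :=
  (#|t.1| == n.+1) && (t.2 \subset facets t.1).

Definition tile_face (V : finType) (t : tile V) (a : {set V}) :=
  (a \subset t.1) && [forall f in t.2, ~~ (a \subset f)].

(** The vertices opposite to the removed facets. *)
Definition opposite (V : finType) (t : tile V) : {set V} :=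
  [set x in t.1 | t.1 :\ x \in t.2].

Definition type_count (V : finType) (T : {set tile V}) (s : nat) : nat :=
  #|[set t in T | #|t.2| == s]|.

Lemma setD1_injective (V : finType) (A : {set V}) :
  {in A &, injective (fun x => A :\ x)}.
Proof.
move=> x y xA yA /setP/(_ x); rewrite !inE xA eqxx /= andbT.
by move=> /esym/negbFE/eqP.
Qed.

Lemma opposite_setD1 (V : finType) (A B : {set V}) :
  B \subset A -> opposite (A, [set A :\ x | x in B]) = B.
Proof.
move=> /subsetP BA; apply/setP => x; rewrite inE /=.
apply/andP/idP => [[xA /imsetP[y yB]]|xB]; last by split; [exact: BA | exact: imset_f].
by move=> /(setD1_injective xA (BA _ yB)) ->.
Qed.

Lemma facets_opposite (V : finType) (t : tile V) : t.2 \subset facets t.1 ->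
  t.2 = [set t.1 :\ x | x in opposite t].
Proof.
move=> /subsetP tf; apply/setP => f; apply/idP/imsetP => [ft|[x]]; last first.
  by rewrite inE => /andP[_ xt] ->.
have := tf _ ft; rewrite inE => /andP[sub /eqP card_f].
have /cards1P[x ex] : #|t.1 :\: f| == 1.
  by rewrite cardsD (setIidPr sub) -card_f subSnn.
have ef : f = t.1 :\ x by rewrite -ex setDDr setDv set0U (setIidPr sub).
exists x => //; rewrite inE -ef ft andbT.
by have /setDP[] : x \in t.1 :\: f by rewrite ex set11.
Qed.

Lemma card_opposite (V : finType) (t : tile V) : t.2 \subset facets t.1 ->
  #|opposite t| = #|t.2|.
Proof.
move=> tf; rewrite [in RHS](facets_opposite tf) card_in_imset // => x y.
by rewrite !inE => /andP[xt _] /andP[yt _]; apply: setD1_injective.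
Qed.

Lemma opposite_sub (V : finType) (t : tile V) : opposite t \subset t.1.
Proof. by apply/subsetP => x; rewrite inE => /andP[]. Qed.

Lemma tile_faceE (V : finType) (t : tile V) (a : {set V}) :
    t.2 \subset facets t.1 ->
  tile_face t a = (opposite t \subset a) && (a \subset t.1).
Proof.
move=> tf; rewrite /tile_face andbC.
have [at1|] := boolP (a \subset t.1); rewrite ?andbF // !andbT.
apply/forall_inP/subsetP => [na x xo|oa f].
  move: xo; rewrite inE => /andP[_ /na].
  by apply: contraR => xa; rewrite subsetD1 at1.
rewrite (facets_opposite tf) => /imsetP[x /oa xa ->].
by rewrite subsetD1 xa andbF.
Qed.

Lemma card_set_between (V : finType) (A B : {set V}) (j : nat) : A \subset B ->
  #|[set a : {set V} | [&& A \subset a, a \subset B & #|a| == j]]| =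
  if #|A| <= j then 'C(#|B| - #|A|, j - #|A|) else 0.
Proof.
move=> AB; case: leqP => [Aj|jA]; last first.
  apply/eqP; rewrite cards_eq0; apply/eqP/setP => a; rewrite !inE.
  apply/negP => /and3P[/subset_leq_card Aa _ /eqP aj].
  by rewrite aj leqNgt jA in Aa.
have -> : #|B| - #|A| = #|B :\: A| by rewrite cardsD (setIidPr AB).
rewrite -cards_draws -[RHS](@card_in_imset _ _ (fun a => A :|: a)); last first.
  move=> a b; rewrite !inE !subsetD => /andP[/andP[_ aA] _] /andP[/andP[_ bA] _].
  move=> /(congr1 (fun c => c :\: A)).
  by rewrite !setDUl setDv !set0U !(setDidPl _).
apply: eq_card => a; rewrite inE; apply/and3P/imsetP => [[Aa aB /eqP aj]|[b]].
  exists (a :\: A); last by rewrite setDE setUIr setUCr setIT; apply/esym/setUidPr.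
  by rewrite inE setSD //= cardsD (setIidPr Aa) aj.
rewrite inE subsetD => /andP[/andP[bB bA] /eqP bj] ->; split.
- exact: subsetUl.
- by rewrite subUset AB.
- rewrite cardsU (_ : A :&: b = set0) ?cards0 ?bj ?subn0 ?subnKC //.
  by apply/eqP; rewrite setI_eq0 disjoint_sym.
Qed.

(** Combinatorial counterpart of a tiling of the union of the relatively open
    faces selected by P: each non-empty face lies in one tile if it is selected, and
    in none otherwise. The empty face is left out since it carries no point. *)
Definition face_tiling (V : finType) (n : nat) (P : pred {set V})
    (T : {set tile V}) : Prop :=
  (forall t, t \in T -> regular_tile n t) /\
  (forall a, a != set0 -> #|[set t in T | tile_face t a]| = P a).

(** The number of faces with j vertices of a tile with s removed facets; the
    comparison of s and j compensates for the truncated subtraction. *)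
Definition tile_face_count (n s j : nat) : nat :=
  if s <= j then 'C(n.+1 - s, j - s) else 0.

Lemma card_tile_faces (V : finType) (n : nat) (t : tile V) (j : nat) :
    regular_tile n t ->
  #|[set a | tile_face t a & #|a| == j]| = tile_face_count n #|t.2| j.
Proof.
move=> /andP[/eqP tn tf].
rewrite /tile_face_count -tn -(card_opposite tf) -card_set_between ?opposite_sub //.
by apply: eq_card => a; rewrite !inE tile_faceE // andbA.
Qed.

Lemma regular_tile_type (V : finType) n (t : tile V) : regular_tile n t ->
  #|t.2| < n.+2.
Proof.
move=> /andP[/eqP tn tf].
by rewrite -(card_opposite tf) ltnS -tn subset_leq_card ?opposite_sub.
Qed.

Lemma sum_by_type (V : finType) (n : nat) (T : {set tile V}) (g : nat -> nat) :
    (forall t, t \in T -> regular_tile n t) ->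
  \sum_(t in T) g #|t.2| = \sum_(s < n.+2) type_count T s * g s.
Proof.
move=> T_reg.
rewrite (partition_big (fun t : tile V => inord #|t.2| : 'I_n.+2) xpredT) //=.
apply: eq_bigr => s _; rewrite -sum_nat_const.
have type_inord t : t \in T -> (inord #|t.2| == s) = (#|t.2| == s).
  by move=> /T_reg/regular_tile_type tn; rewrite -val_eqE /= inordK.
rewrite [LHS](eq_bigl (fun t => t \in [set t in T | #|t.2| == s])) => [|t].
  by apply: eq_bigr => t; rewrite inE => /andP[_ /eqP ->].
by rewrite inE; case tT: (t \in T) => //=; apply: type_inord.
Qed.

(** Double counting of the pairs of a tile and a face of it with j vertices. *)
Lemma face_tiling_count (V : finType) (n j : nat) (P : pred {set V})
    (T : {set tile V}) :
    face_tiling n P T -> 0 < j ->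
  \sum_(s < n.+2) type_count T s * tile_face_count n s j =
  #|[set a | P a & #|a| == j]|.
Proof.
move=> [T_reg T_faces] j_gt0.
rewrite -(sum_by_type (tile_face_count n ^~ j) T_reg).
transitivity (\sum_(t in T) \sum_(a : {set V} | #|a| == j) (tile_face t a : nat)).
  apply: eq_bigr => t /T_reg tr; rewrite -(card_tile_faces j tr).
  rewrite -sum1_card big_mkcond [RHS]big_mkcond /=.
  by apply: eq_bigr => a _; rewrite inE; case: (tile_face t a); case: eqP.
rewrite exchange_big /= -sum1_card big_mkcond [RHS]big_mkcond /=.
apply: eq_bigr => a _; rewrite inE; case: eqP => [aj|]; rewrite ?andbF //=.
have a0 : a != set0 by rewrite -card_gt0 aj.
rewrite andbT -[RHS]/(nat_of_bool (P a)) -(T_faces a a0) -sum1_card.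
rewrite big_mkcond [RHS]big_mkcond /=.
by apply: eq_bigr => t _; rewrite inE; case: (t \in T).
Qed.

(** The equations of [face_tiling_count] for j > 0 are unitriangular in the numbers
    of tiles; only the equation for the empty face is missing, and the hypothesis on
    the tiles of type 0 replaces it. *)
Lemma face_tiling_type_count (V V' : finType) (n : nat)
    (P : pred {set V}) (P' : pred {set V'})
    (T : {set tile V}) (T' : {set tile V'}) :
    face_tiling n P T -> face_tiling n P' T' ->
    (forall j, #|[set a | P a & #|a| == j]| = #|[set a | P' a & #|a| == j]|) ->
    type_count T 0 = type_count T' 0 ->
  forall s, s < n.+2 -> type_count T s = type_count T' s.
Proof.
move=> hT hT' PP' h0 s; elim/ltn_ind: s => -[//|s] IH sn.
have := face_tiling_count hT (ltn0Sn s); rewrite PP'.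
rewrite -(face_tiling_count hT' (ltn0Sn s)).
rewrite (bigD1 (Ordinal sn)) //= [RHS](bigD1 (Ordinal sn)) //=.
have -> : tile_face_count n s.+1 s.+1 = 1 by rewrite /tile_face_count leqnn subnn bin0.
rewrite !muln1; set x := \sum_(_ < _ | _) _; set y := \sum_(_ < _ | _) _.
suff -> : x = y by exact: addIn.
apply: eq_bigr => k ks; rewrite /tile_face_count; case: leqP => kj; last by rewrite !muln0.
by rewrite IH // ltn_neqAle kj andbT.
Qed.

(** * The tiling of the subdivided standard tile by words *)

(** A chain c of non-empty subsets of a simplex lies in the subdivision of a facet
    exactly when no member of c contains the opposite vertex. So the simplices of
    the subdivided tile are the chains whose union contains the vertices opposite
    to the removed facets; the empty chain satisfies the condition when there is
    no such vertex. *)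
Definition sd_face (V : finType) (t : tile V) (c : {set {set V}}) :=
  [&& is_chain c, set0 \notin c, cover c \subset t.1 & opposite t \subset cover c].

Definition flag_tile (n s : nat) (w : 'S_n.+1) : tile {set 'I_n.+1} :=
  (flag w, [set flag w :\ initial_set w i | i in ascents s w]).

Lemma flag_tileE n s (w : 'S_n.+1) :
  flag_tile s w =
    (flag w, [set flag w :\ A | A in [set initial_set w i | i in ascents s w]]).
Proof. by rewrite -imset_comp. Qed.

Lemma cuts_sub_flag n s (w : 'S_n.+1) :
  [set initial_set w i | i in ascents s w] \subset flag w.
Proof. by apply/subsetP => _ /imsetP[i _ ->]; apply: imset_f. Qed.

Lemma flag_tile_regular n s (w : 'S_n.+1) : regular_tile n (flag_tile s w).
Proof.
rewrite /regular_tile /= card_flag eqxx /=; apply/subsetP => _ /imsetP[i _ ->].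
have iw : initial_set w i \in flag w by apply: imset_f.
by rewrite inE subsetDl /= (cardsD1 (initial_set w i) (flag w)) iw.
Qed.

Lemma flag_tile_face n s (w : 'S_n.+1) c :
  tile_face (flag_tile s w) c = flag_interval s w c.
Proof.
rewrite tile_faceE; last by case/andP: (flag_tile_regular s w).
by rewrite flag_tileE opposite_setD1 ?cuts_sub_flag.
Qed.

Lemma flag_tile_type n s (w : 'S_n.+1) : #|(flag_tile s w).2| = #|ascents s w|.
Proof.
rewrite card_in_imset // => i j _ _ /setD1_injective e.
by apply: (@initial_set_inj _ w); apply: e; apply: imset_f.
Qed.

(** The simplex of the tile of w is itself a face of this tile, and a chain is a
    face of only one of these tiles. *)
Lemma flag_tile_inj n s : injective (@flag_tile n s).
Proof.
move=> w w' e; apply: (@flag_interval_uniq _ s _ _ (flag w)).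
  by rewrite /flag_interval cuts_sub_flag subxx.
by rewrite -flag_tile_face -e flag_tile_face /flag_interval cuts_sub_flag subxx.
Qed.

Definition flag_tiling (n s : nat) : {set tile {set 'I_n.+1}} :=
  [set flag_tile s w | w : 'S_n.+1].

Lemma flag_tiling_type_count n s k :
  type_count (flag_tiling n s) k = ascent_count n s k.
Proof.
rewrite /type_count /ascent_count -[RHS](card_imset _ (@flag_tile_inj n s)).
apply: eq_card => t; rewrite inE; apply/andP/imsetP => [[/imsetP[w _ ->]]|[w]].
  by rewrite flag_tile_type => wk; exists w; rewrite ?inE.
by rewrite inE => wk ->; rewrite flag_tile_type wk imset_f.
Qed.

Lemma standard_tileE n s :
  standard_tile n s = (setT, [set setT :\ i | i in [set i : 'I_n.+1 | i < s]]).
Proof.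
congr (_, _); apply/setP => f; rewrite inE; apply/existsP/imsetP.
  by move=> [i /andP[si /eqP ->]]; exists i; rewrite ?inE.
by move=> [i]; rewrite inE => si ->; exists i; rewrite si eqxx.
Qed.

Lemma opposite_standard_tile n s :
  opposite (standard_tile n s) = [set i : 'I_n.+1 | i < s].
Proof. by rewrite standard_tileE opposite_setD1 ?subsetT. Qed.

Lemma standard_tile_regular n s : regular_tile n (standard_tile n s).
Proof.
rewrite standard_tileE /regular_tile /= cardsT card_ord eqxx /=.
apply/subsetP => _ /imsetP[i _ ->].
by rewrite inE subsetT /= (cardsD1 i [set: 'I_n.+1]) inE.
Qed.

Lemma standard_tile_type n s : s <= n.+1 -> #|(standard_tile n s).2| = s.
Proof.
move=> sn; case/andP: (standard_tile_regular n s) => _ /card_opposite <-.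
rewrite opposite_standard_tile -sum1_card.
rewrite (eq_bigl (fun i : 'I_n.+1 => i < s)) => [|i]; last by rewrite inE.
by rewrite (big_ord_narrow sn) sum1_card card_ord.
Qed.

Lemma flag_tiling_faces n s :
  face_tiling n (sd_face (standard_tile n s)) (flag_tiling n s).
Proof.
split=> [_ /imsetP[w _ ->]|c c0]; first exact: flag_tile_regular.
have -> : [set t in flag_tiling n s | tile_face t c] =
    @flag_tile n s @: [set w | flag_interval s w c].
  apply/setP => t; rewrite inE; apply/andP/imsetP => [[/imsetP[w _ ->]]|[w]].
    by rewrite flag_tile_face; exists w; rewrite ?inE.
  by rewrite inE => wc ->; rewrite imset_f // flag_tile_face.
rewrite card_imset; last exact: flag_tile_inj.
have [/and4P[ch c_ne _ cov]|] := boolP (sd_face _ c).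
  have [x xs|w wc] := @flag_interval_exists n s c ch c_ne.
    by apply: (subsetP cov); rewrite opposite_standard_tile inE.
  apply/eqP/cards1P; exists w; apply/setP => v; rewrite !inE.
  by apply/idP/eqP => [/flag_interval_uniq|->//]; apply.
move=> c_not; apply/eqP; rewrite cards_eq0; apply/eqP/setP => w; rewrite !inE.
apply/negP => wc; case/negP: c_not; have /andP[_ cw] := wc.
apply/and4P; split.
- exact: flag_chain cw.
- exact: flag_no_set0 cw.
- exact: subsetT.
- by apply/subsetP => x; rewrite opposite_standard_tile inE; apply: (flag_interval_cover wc).
Qed.

(** List the elements of A first, then those of B outside A. *)
Lemma exists_enumeration (V : finType) (n : nat) (A B : {set V}) :
    A \subset B -> #|B| = n.+1 ->
  exists f : 'I_n.+1 -> V, [/\ injective f, f @: setT = B &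
    f @: [set i : 'I_n.+1 | i < #|A|] = A].
Proof.
move=> AB Bn; pose l := enum A ++ enum (B :\: A).
have l_size : size l = n.+1.
  by rewrite size_cat -!cardE cardsD (setIidPr AB) subnKC ?subset_leq_card.
have l_uniq : uniq l.
  rewrite cat_uniq !enum_uniq andbT /=; apply/hasPn => x.
  by rewrite !mem_enum => /setDP[].
have x0 : V by case: (enum B) (cardE B) => [|x _ _ //]; rewrite Bn.
pose f (i : 'I_n.+1) := nth x0 l i.
have f_inj : injective f.
  by move=> i j /eqP; rewrite nth_uniq ?l_size // => /eqP/val_inj.
exists f; split=> //.
  apply/eqP; rewrite eqEcard card_imset // cardsT card_ord Bn leqnn andbT.
  apply/subsetP => _ /imsetP[i _ ->].
  have := mem_nth x0 (_ : i < size l); rewrite l_size ltn_ord => /(_ isT).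
  rewrite mem_cat !mem_enum => /orP[/(subsetP AB)//|/setDP[]//].
apply/eqP; rewrite eqEcard card_imset //; apply/andP; split.
  apply/subsetP => x /imsetP[i]; rewrite inE => iA ->.
  by rewrite /f nth_cat -cardE iA -mem_enum mem_nth // -cardE.
have An : #|A| <= n.+1 by rewrite -Bn subset_leq_card.
rewrite -[X in _ <= X]sum1_card.
rewrite (eq_bigl (fun i : 'I_n.+1 => i < #|A|)) => [|i]; last by rewrite inE.
by rewrite (big_ord_narrow An) sum1_card card_ord.
Qed.

(** An enumeration of the vertices of t starting with the ones opposite to the
    removed facets transports the chains of the standard tile to those of t. *)
Lemma card_sd_faces (V : finType) (n j : nat) (t : tile V) : regular_tile n t ->
  #|[set c | sd_face t c & #|c| == j]| =
  #|[set c | sd_face (standard_tile n #|t.2|) c & #|c| == j]|.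
Proof.
move=> /andP[/eqP tn tf].
have [f [f_inj fT fO]] := exists_enumeration (opposite_sub t) tn.
rewrite card_opposite // in fO.
pose F (A : {set 'I_n.+1}) := f @: A.
have F_inj : injective F by exact: imset_inj.
have F_sub A B : (F A \subset F B) = (A \subset B).
  apply/idP/idP => [FAB|]; last exact: imsetS.
  apply/subsetP => x xA; have := subsetP FAB (f x) (imset_f _ xA).
  by rewrite mem_imset.
have F_cover (c : {set {set 'I_n.+1}}) : cover (F @: c) = F (cover c).
  apply/setP => x; apply/bigcupP/imsetP => [[_ /imsetP[A Ac ->] /imsetP[y yA ->]]|].
    by exists y => //; apply/bigcupP; exists A.
  move=> [y /bigcupP[A Ac yA] ->]; exists (F A); apply: imset_f => //.
rewrite -[RHS](card_imset _ (imset_inj F_inj)).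
have sd_F (c : {set {set 'I_n.+1}}) :
    sd_face t (F @: c) = sd_face (standard_tile n #|t.2|) c.
  rewrite /sd_face opposite_standard_tile F_cover /= -fT -{1}fO !F_sub.
  congr [&& _, _, _ & _].
    apply/forall_inP/forall_inP => ch A Ac.
      apply/forall_inP => B Bc; rewrite -!F_sub.
      by apply: (forall_inP (ch _ (imset_f F Ac))); apply: imset_f.
    apply/forall_inP => B; case/imsetP: Ac => {}A Ac -> /imsetP[{}B Bc ->].
    by rewrite !F_sub (forall_inP (ch _ Ac)).
  by rewrite -[X in X \notin _](imset0 f) (mem_imset _ _ F_inj).
apply: eq_card => c; apply/idP/imsetP => [|[d]]; rewrite !inE.
  move=> /andP[tc cj]; pose c' := [set A | F A \in c].
  have ec : c = F @: c'.
    apply/setP => B; apply/idP/imsetP => [Bc|[A]]; last by rewrite inE => Ac ->.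
    have Bt : B \subset t.1.
      case/and4P: tc => _ _ /subsetP cov _; apply/subsetP => x xB; apply: cov.
      by apply/bigcupP; exists B.
    have eB : B = F (f @^-1: B).
      apply/setP => x; apply/idP/imsetP => [xB|[y]]; last by rewrite inE => yB ->.
      have := subsetP Bt _ xB; rewrite -fT => /imsetP[y _ ex].
      by exists y; rewrite ?inE -?ex.
    by exists (f @^-1: B); rewrite ?inE -?eB.
  by exists c'; rewrite // inE -sd_F -ec tc -(card_imset _ F_inj) -ec.
by move=> /andP[ds dj] ->; rewrite sd_F ds card_imset.
Qed.

(** * Tilings by points and tilings by faces *)

From HB Require Import structures.
From mathcomp Require Import all_order all_algebra.
From mathcomp Require Import all_classical all_reals all_analysis.
Import Order.TTheory GRing.Theory Num.Theory.
Import numFieldNormedType.Exports.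
Local Open Scope classical_set_scope.
Local Open Scope ring_scope.

Definition barycentric (R : realType) (V : finType) (x : {ffun V -> R}) : Prop :=
  (forall v, 0 <= x v) /\ \sum_v x v = 1.

(** The smallest face containing the point x. *)
Definition carrier (R : realType) (V : finType) (x : {ffun V -> R}) : {set V} :=
  finset (fun v => x v != 0).

Lemma carrier_neq0 (R : realType) (V : finType) (x : {ffun V -> R}) :
  barycentric x -> carrier x != finset.set0.
Proof.
move=> [_ sum1]; apply/eqP => c0; have := oner_neq0 R; rewrite -sum1.
rewrite big1 ?eqxx // => v _; apply/eqP/negPn/negP => xv.
have : v \in carrier x by rewrite inE.
by rewrite c0 inE.
Qed.

Lemma exists_carrier (R : realType) (V : finType) (a : {set V}) :
  a != finset.set0 -> exists x : {ffun V -> R}, barycentric x /\ carrier x = a.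
Proof.
move=> a0; have card0 : #|a|%:R != 0 :> R by rewrite pnatr_eq0 -lt0n card_gt0.
exists [ffun v => if v \in a then #|a|%:R^-1 else 0]; split; last first.
  apply/setP => v; rewrite inE ffunE; case: ifP; last by rewrite eqxx.
  by rewrite invr_eq0 card0.
split=> [v|]; first by rewrite ffunE; case: ifP => // _; rewrite invr_ge0.
under eq_bigr do rewrite ffunE.
by rewrite -big_mkcond /= sumr_const -[RHS](mulVf card0) mulr_natr.
Qed.

Lemma realizationE (R : realType) (V : finType) (K : {set {set V}})
    (x : {ffun V -> R}) :
  realization R K x <-> barycentric x /\ carrier x \in K.
Proof. by split=> [[]|[[]]]. Qed.

(** Covers both tiles (L being the closed simplex) and subdivided tiles (L being
    its subdivision). *)
Lemma realization_diffE (R : realType) (V I : finType) (K : {set {set V}})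
    (D : {set I}) (L : I -> {set {set V}}) (x : {ffun V -> R}) :
  (realization R K `\` \bigcup_(f in [set` D]) realization R (L f)) x <->
  barycentric x /\ (carrier x \in K) && [forall f in D, carrier x \notin L f].
Proof.
split=> [[/realizationE[bx xK] nx]|[bx /andP[xK /forall_inP nx]]].
  split=> //; rewrite xK; apply/forall_inP => f fD; apply/negP => xf.
  by apply: nx; exists f => //; apply/realizationE.
split; first exact/realizationE.
by move=> [f /= /nx xf /realizationE[_ fx]]; rewrite fx in xf.
Qed.

Lemma tile_pointsE (R : realType) (V : finType) (t : tile V) (x : {ffun V -> R}) :
  tile_points R t x <-> barycentric x /\ tile_face t (carrier x).
Proof.
have e : barycentric x ->
    ((carrier x \in closed_simplex t.1) &&
       [forall f in t.2, carrier x \notin closed_simplex f]) = tile_face t (carrier x).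
  move=> /carrier_neq0 c0; rewrite inE c0 /=; congr (_ && _).
  by apply: eq_forallb => f; rewrite inE c0.
rewrite /tile_points realization_diffE; split=> -[bx xt].
  by rewrite -e.
by rewrite e.
Qed.

Lemma mem_Sd_closed_simplex (V : finType) (A : {set V}) (c : {set {set V}}) :
  (c \in Sd (closed_simplex A)) =
  [&& c != finset.set0, is_chain c, finset.set0 \notin c & finset.cover c \subset A].
Proof.
rewrite inE; congr (_ && _); rewrite andbC; congr (_ && _).
apply/fintype.subsetP/andP => [cA|[c0 cov] B Bc].
  split; first by apply/negP => /cA; rewrite inE eqxx.
  by apply/finset.bigcupsP => B /cA; rewrite inE => /andP[].
rewrite inE (fintype.subset_trans _ cov) ?andbT; last exact: (finset.bigcup_sup B).
by apply: contraNneq c0 => <-.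
Qed.

Lemma Sd_tile_pointsE (R : realType) (V : finType) (t : tile V)
    (x : {ffun {set V} -> R}) : t.2 \subset facets t.1 ->
  Sd_tile_points R t x <-> barycentric x /\ sd_face t (carrier x).
Proof.
move=> tf; have e : barycentric x ->
    ((carrier x \in Sd (closed_simplex t.1)) &&
      [forall f in t.2, carrier x \notin Sd (closed_simplex f)]) =
    sd_face t (carrier x).
  move=> /carrier_neq0 c0; rewrite mem_Sd_closed_simplex /sd_face c0 /= -!andbA.
  case ch: (is_chain _) => //=; case cn: (_ \notin _) => //=.
  rewrite [RHS]andbC -tile_faceE // /tile_face; congr (_ && _).
  apply: eq_forallb => f; congr (_ ==> ~~ _).
  by rewrite mem_Sd_closed_simplex c0 ch cn.
rewrite /Sd_tile_points realization_diffE; split=> -[bx xt].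
  by rewrite -e.
by rewrite e.
Qed.

Lemma is_tile_regular (V : finType) n (K : {set {set V}}) (t : tile V) :
  is_tile n K t -> regular_tile n t.
Proof. by case=> _ /eqP tn tf; apply/andP. Qed.

(** A tile containing one point of a relatively open face contains all of it, and
    every non-empty face is the carrier of its barycenter. *)
Lemma tiling_of_face_tiling (R : realType) (V : finType) (n : nat)
    (K : {set {set V}}) (X : set {ffun V -> R}) (P : pred {set V})
    (T : {set tile V}) :
    (forall x, X x <-> barycentric x /\ P (carrier x)) ->
  tiling_of n K X T -> face_tiling n P T.
Proof.
move=> XP [Tt [cov triv _]]; split=> [t /Tt /is_tile_regular //|a a0].
have [x [bx xa]] := exists_carrier R a0; case Pa: (P a); last first.
  apply/eqP; rewrite cards_eq0; apply/eqP/setP => t; rewrite !inE.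
  apply/negP => /andP[tT ta]; have : X x.
    by rewrite -cov; exists t => //; apply/tile_pointsE; rewrite xa.
  by move=> /XP[_]; rewrite xa Pa.
have : X x by apply/XP; rewrite xa.
rewrite -cov => -[t tT /tile_pointsE[_]]; rewrite xa => ta.
apply/eqP/cards1P; exists t; apply/setP => u; rewrite !inE.
apply/andP/eqP => [[uT ua]|->]; last by split.
by apply: triv => //; exists x; split; apply/tile_pointsE; rewrite xa.
Qed.

Lemma tile_face_full (V : finType) (n : nat) (t : tile V) :
  regular_tile n t -> tile_face t t.1 /\ t.1 != finset.set0.
Proof.
move=> /andP[/eqP tn tf]; rewrite tile_faceE // subxx opposite_sub.
by split=> //; rewrite -card_gt0 tn.
Qed.

Lemma face_tiling_tiling_of (R : realType) (V : finType) (n : nat)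
    (K : {set {set V}}) (X : set {ffun V -> R}) (P : pred {set V})
    (T : {set tile V}) :
    (forall x, X x <-> barycentric x /\ P (carrier x)) ->
    (forall t, t \in T -> t.1 \in K) ->
  face_tiling n P T -> tiling_of n K X T.
Proof.
move=> XP TK [T_reg T_face]; split.
  by move=> t tT; have /andP[/eqP tn tf] := T_reg _ tT; split=> //; exact: TK.
split=> [|t u /= tT uT [x [/tile_pointsE[bx tx] /tile_pointsE[_ ux]]]|t /= tT].
- apply/seteqP; split=> x.
    move=> [t /= tT /tile_pointsE[bx tx]]; apply/XP; split=> //.
    have := T_face _ (carrier_neq0 bx); case: (P _) => // /eqP.
    by rewrite cards_eq0 => /eqP/setP/(_ t); rewrite !inE tT tx.
  move=> /XP[bx Px]; have := T_face _ (carrier_neq0 bx); rewrite Px => /eqP/cards1P[t].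
  move=> /setP/(_ t); rewrite !inE eqxx => /andP[tT tx].
  by exists t => //; apply/tile_pointsE.
- have := T_face _ (carrier_neq0 bx); case: (P _) => /eqP; last first.
    by rewrite cards_eq0 => /eqP/setP/(_ t); rewrite !inE tT tx.
  move=> /cards1P[v /setP ev]; have := ev t; have := ev u.
  by rewrite !inE tT uT tx ux /= => /esym/eqP -> /esym/eqP ->.
- have [tt t0] := tile_face_full (T_reg _ tT).
  have [x [bx xt]] := exists_carrier R t0.
  by exists x; apply/tile_pointsE; rewrite xt.
Qed.

Lemma h_vectorE (R : realType) (V : finType) n (T : {set tile V}) s :
  h_vector R n T s 0 = (type_count T s)%:R.
Proof. by rewrite mxE. Qed.

Lemma Sd_tile_tiling_faces (R : realType) (V : finType) (n : nat) (t : tile V)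
    (T : {set tile {set V}}) :
    regular_tile n t -> Sd_tile_tiling R n t T ->
  face_tiling n (sd_face t) T /\ type_count T 0 = (#|t.2| == 0%N).
Proof.
move=> /andP[_ tf] [T_tiling h0]; split.
  by apply: tiling_of_face_tiling T_tiling => x; apply: Sd_tile_pointsE.
by apply/eqP; rewrite -(eqr_nat R) -h0 h_vectorE.
Qed.

Lemma standard_Sd_tile_tiling (R : realType) (n s : nat) : (s <= n.+1)%N ->
  Sd_tile_tiling R n (standard_tile n s) (flag_tiling n s).
Proof.
move=> sn; have /andP[_ tf] := standard_tile_regular n s; split; last first.
  by rewrite h_vectorE flag_tiling_type_count ascent_count0 standard_tile_type.
apply: face_tiling_tiling_of (flag_tiling_faces n s) => [x|t /imsetP[w _ ->]].
  exact: Sd_tile_pointsE.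
rewrite mem_Sd_closed_simplex (flag_chain (subxx _)) (flag_no_set0 (subxx _)).
by rewrite finset.subsetT !andbT -card_gt0 card_flag.
Qed.

(** The tiling T and the tiling by words of the standard tile of the same type as t are
    face tilings with equally many faces and the same number of tiles of type 0. *)
Lemma Sd_tile_tiling_type_count (R : realType) (V : finType) (n s : nat)
    (t : tile V) (T : {set tile {set V}}) :
    regular_tile n t -> Sd_tile_tiling R n t T -> (s <= n.+1)%N ->
  type_count T s = ascent_count n #|t.2| s.
Proof.
move=> tr /(Sd_tile_tiling_faces tr)[T_faces T0] sn.
rewrite -flag_tiling_type_count.
apply: face_tiling_type_count T_faces (flag_tiling_faces _ _) _ _ _ _ => //.
  by move=> j; apply: card_sd_faces.
by rewrite T0 flag_tiling_type_count ascent_count0.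
Qed.

Lemma H_mxE (R : realType) n (s k : 'I_n.+2) :
  H_mx R n s k = (ascent_count n s k)%:R.
Proof.
have sn : (s <= n.+1)%N by rewrite -ltnS ltn_ord.
rewrite mxE h_vectorE (@Sd_tile_tiling_type_count R _ n _ (standard_tile n s)).
- by rewrite standard_tile_type.
- exact: standard_tile_regular.
- by apply: (xgetPex finset.set0); exists (flag_tiling n s); apply: standard_Sd_tile_tiling.
- by rewrite -ltnS ltn_ord.
Qed.

(** * Powers of a stochastic matrix with a positive column *)

Definition l1norm (R : realType) (m : nat) (u : 'rV[R]_m) : R := \sum_i `|u 0 i|.

(** The norm of a matrix is the maximum of the moduli of its entries, so a common
    bound on the entries suffices. *)
Lemma cvg_mx_le (R : realType) (p q : nat) (f : nat -> 'M[R]_(p, q))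
    (l : 'M[R]_(p, q)) (b : nat -> R) :
    (forall d i j, `|l i j - f d i j| <= b d) -> b @ \oo --> (0 : R) ->
  f @ \oo --> l.
Proof.
move=> fb b0; apply/cvgrPdist_le => e e0.
near=> d; have bd : `|b d| <= e by near: d; apply: cvgr0_norm_le.
rewrite /Num.norm /= mx_normrE; apply/bigmax_leP; split=> [|[i j] _]; first exact: ltW.
by rewrite !mxE; apply: le_trans (fb d i j) _; apply: le_trans (ler_norm _) bd.
Unshelve. all: by end_near.
Qed.

Lemma sum_mulmx_stochastic (R : realType) (m : nat) (M : 'M[R]_m) (u : 'rV[R]_m) :
  (forall i, \sum_j M i j = 1) -> \sum_j (u *m M) 0 j = \sum_i u 0 i.
Proof.
move=> M1; under eq_bigr do rewrite mxE.
rewrite exchange_big /=; apply: eq_bigr => i _.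
by rewrite -mulr_sumr M1 mulr1.
Qed.

(** Subtracting e from the column j0 of M does not change the product with a vector
    of sum zero, and leaves a nonnegative matrix with row sums 1 - e. *)
Lemma l1norm_contract (R : realType) (m : nat) (M : 'M[R]_m) (j0 : 'I_m) (e : R)
    (u : 'rV[R]_m) :
    (forall i j, 0 <= M i j) -> (forall i, \sum_j M i j = 1) ->
    (forall i, e <= M i j0) -> \sum_i u 0 i = 0 ->
  l1norm (u *m M) <= (1 - e) * l1norm u.
Proof.
(* M minus e in the column j0; still nonnegative, and u N = u M. *)
move=> M0 M1 Me u0; pose N i j := M i j - e *+ (j == j0).
have uN j : (u *m M) 0 j = \sum_i u 0 i * N i j.
  rewrite mxE; under [RHS]eq_bigr do rewrite mulrBr.
  by rewrite sumrB -mulr_suml u0 mul0r subr0.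
have N0 i j : 0 <= N i j.
  by rewrite /N; case: eqP => [->|_]; rewrite ?mulr1n ?mulr0n ?subr0 // subr_ge0.
have N1 i : \sum_j N i j = 1 - e.
  rewrite sumrB M1 (bigD1 j0) //= eqxx mulr1n big1 ?addr0 // => j /negPf ->.
  by rewrite mulr0n.
apply: (@le_trans _ _ (\sum_j \sum_i `|u 0 i| * N i j)).
  apply: ler_sum => j _; rewrite uN; apply: le_trans (ler_norm_sum _ _ _) _.
  by apply: ler_sum => i _; rewrite normrM (ger0_norm (N0 _ _)).
rewrite exchange_big /= /l1norm mulr_sumr; apply: ler_sum => i _.
by rewrite -mulr_sumr N1 mulrC.
Qed.

Lemma l1norm_eq0 (R : realType) (m : nat) (u : 'rV[R]_m) : l1norm u <= 0 -> u = 0.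
Proof.
move=> u0; have /eqP : l1norm u = 0 by apply/le_anti; rewrite u0 sumr_ge0.
rewrite psumr_eq0 // => /allP z; apply/rowP => i; rewrite mxE.
by apply/eqP; rewrite -normr_eq0; apply: z; rewrite mem_index_enum.
Qed.

Lemma stationary_zero (R : realType) (m : nat) (M : 'M[R]_m) (j0 : 'I_m) (e : R)
    (u : 'rV[R]_m) :
    (forall i j, 0 <= M i j) -> (forall i, \sum_j M i j = 1) -> 0 < e ->
    (forall i, e <= M i j0) -> \sum_i u 0 i = 0 -> u *m M = u ->
  u = 0.
Proof.
move=> M0 M1 e0 Me u0 uM; apply: l1norm_eq0.
have := l1norm_contract M0 M1 Me u0; rewrite uM mulrBl mul1r lerBrDr gerDl.
by rewrite pmulr_rle0.
Qed.

(** Since 1 is an eigenvalue of M for the constant column, it is also one for a row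
    vector v; the sum of v is not zero by the contraction, so v can be normalized. *)
Lemma exists_stationary (R : realType) (m : nat) (M : 'M[R]_m) (j0 : 'I_m) (e : R) :
    (forall i j, 0 <= M i j) -> (forall i, \sum_j M i j = 1) -> 0 < e ->
    (forall i, e <= M i j0) ->
  exists p : 'rV[R]_m, p *m M = p /\ \sum_i p 0 i = 1.
Proof.
move=> M0 M1 e0 Me.
have : \det (M - 1%:M) == 0.
  rewrite -det_tr; apply/det0P; exists (const_mx 1).
    by apply/eqP => /rowP/(_ j0)/eqP; rewrite !mxE oner_eq0.
  apply/rowP => i; rewrite !mxE.
  under eq_bigr do rewrite !mxE mul1r.
  rewrite sumrB M1 (bigD1 i) //= eqxx big1 ?addr0 ?subrr // => j.
  by rewrite eq_sym => /negPf ->.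
case/det0P => v v0; rewrite mulmxBr mulmx1 => /eqP; rewrite subr_eq0 => /eqP vM.
have s0 : \sum_i v 0 i != 0.
  by apply: contraNneq v0 => s0; rewrite (stationary_zero M0 M1 e0 Me s0 vM).
exists ((\sum_i v 0 i)^-1 *: v); split; first by rewrite -scalemxAl vM.
under eq_bigr do rewrite mxE.
by rewrite -mulr_sumr mulVf.
Qed.

(** The rows of U M^d minus p have sum zero, so each multiplication by M contracts
    them by the factor 1 - e. A bound by entries, rather than a limit, is given
    because it serves for both a matrix and its transpose. *)
Lemma stochastic_power_bound (R : realType) (m : nat) (M : 'M[R]_m.+1) (j0 : 'I_m.+1)
    (e : R) (p : 'rV[R]_m.+1) (k : nat) (U : 'M[R]_(k, m.+1)) :
    (forall i j, 0 <= M i j) -> (forall i, \sum_j M i j = 1) -> 0 < e ->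
    (forall i, e <= M i j0) -> p *m M = p -> \sum_i p 0 i = 1 ->
    (forall i, \sum_j U i j = 1) ->
  exists2 b : nat -> R, b @ \oo --> (0 : R) &
    forall d i j, `|p 0 j - (U *m M ^+ d) i j| <= b d.
Proof.
move=> M0 M1 e0 Me pM p1 U1.
have e1 : e <= 1.
  by rewrite -(M1 ord0) (bigD1 j0) //= (le_trans (Me ord0)) // lerDl sumr_ge0.
have small : `|1 - e| < 1 by rewrite ger0_norm ?subr_ge0 // gtrBl.
have bound i d : l1norm (p - row i (U *m M ^+ d)) <= (1 - e) ^+ d * l1norm (p - row i U) /\
    \sum_j (p - row i (U *m M ^+ d)) 0 j = 0.
  elim: d => [|d [IH1 IH2]].
    rewrite expr0 mulmx1 mul1r; split=> //.
    under eq_bigr do rewrite !mxE.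
    by rewrite sumrB p1 U1 subrr.
  have -> : p - row i (U *m M ^+ d.+1) = (p - row i (U *m M ^+ d)) *m M.
    by rewrite mulmxBl pM exprSr mulmxA row_mul.
  rewrite (sum_mulmx_stochastic _ M1); split=> //.
  apply: le_trans (l1norm_contract M0 M1 Me IH2) _.
  by rewrite exprS -mulrA ler_wpM2l // subr_ge0.
pose C := \sum_i l1norm (p - row i U).
exists (geometric C (1 - e)); first exact: cvg_geometric.
move=> d i j.
have := (bound i d).1; rewrite /geometric /= => le_d.
apply: le_trans (le_trans _ le_d) _.
  rewrite /l1norm (bigD1 j) //= !mxE lerDl sumr_ge0 //.
rewrite mulrC ler_wpM2r ?exprn_ge0 ?subr_ge0 //.
by rewrite /C (bigD1 i) //= lerDl sumr_ge0 // => l _; apply: sumr_ge0.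
Qed.

(** * h-vectors of iterated subdivisions *)

(** The members of a chain are distinguished by their cardinals, which lie between
    1 and the cardinal of the union. *)
Lemma chain_card_cover (V : finType) (c : {set {set V}}) :
  is_chain c -> finset.set0 \notin c -> (#|c| <= #|finset.cover c|)%N.
Proof.
move=> /forall_inP ch c0; pose f (A : {set V}) : 'I_(#|finset.cover c|).+1 := inord #|A|.
have fE A : A \in c -> f A = #|A| :> nat.
  by move=> Ac; rewrite inordK // ltnS subset_leq_card //; exact: (finset.bigcup_sup A).
have f_inj : {in c &, injective f}.
  move=> A B Ac Bc /(congr1 (@nat_of_ord _)); rewrite !fE // => eAB.
  apply/eqP; case/orP: (forall_inP (ch _ Ac) _ Bc) => sub; last rewrite eq_sym.
    by rewrite eqEcard sub eAB leqnn.
  by rewrite eqEcard sub eAB leqnn.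
rewrite -(card_in_imset f_inj).
suff : (#|(f @: c)%SET| <= #|[set~ (@ord0 #|finset.cover c|)]%SET|)%N.
  by rewrite cardsC1 card_ord.
apply/subset_leq_card/fintype.subsetP => _ /imsetP[A Ac ->].
rewrite !inE -val_eqE /= fE // cards_eq0.
by apply: contraNneq c0 => <-.
Qed.

(** The part of the tiling property that subdivision has to preserve for the
    h-vectors to be multiplied by the transpose of H_n. Two tiles with the same simplex
    share its interior, so they coincide in a tiling. *)
Definition pure_tiles (V : finType) (n : nat) (T : {set tile V}) : Prop :=
  (forall t, t \in T -> regular_tile n t) /\ {in T &, injective fst}.

Lemma face_tiling_full (V : finType) (n : nat) (P : pred {set V})
    (T : {set tile V}) (t : tile V) : face_tiling n P T -> t \in T -> P t.1.
Proof.
move=> [T_reg T_face] tT; have [tt t0] := tile_face_full (T_reg _ tT).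
have := T_face _ t0; case: (P _) => // /eqP.
by rewrite cards_eq0 => /eqP/finset.setP/(_ t); rewrite !inE tT tt.
Qed.

Lemma face_tiling_pure (V : finType) (n : nat) (P : pred {set V})
    (T : {set tile V}) : face_tiling n P T -> pure_tiles n T.
Proof.
move=> T_tiling; have [T_reg T_face] := T_tiling; split=> // t u tT uT tu.
have [tt t0] := tile_face_full (T_reg _ tT).
have [ut _] := tile_face_full (T_reg _ uT).
have := T_face _ t0; rewrite (face_tiling_full T_tiling tT) => /eqP/cards1P[v].
move=> /finset.setP ev; have := ev t; have := ev u.
by rewrite !inE tT uT tt tu ut => /esym/eqP -> /esym/eqP ->.
Qed.

Lemma realization_tiling_pure (R : realType) (V : finType) (n : nat)
    (K : {set {set V}}) (T : {set tile V}) : tiling R n K T -> pure_tiles n T.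
Proof.
move=> T_tiling; apply: (face_tiling_pure (P := fun a => a \in K)).
by apply: tiling_of_face_tiling T_tiling => x; apply: realizationE.
Qed.

(** The chain u.1 has n + 1 members inside the n + 1 vertices of t. It follows that
    an n-simplex of the subdivision determines the tile in which it lies. *)
Lemma Sd_tile_cover (R : realType) (V : finType) (n : nat) (t : tile V)
    (T : {set tile {set V}}) (u : tile {set V}) :
    regular_tile n t -> Sd_tile_tiling R n t T -> u \in T ->
  finset.cover u.1 = t.1.
Proof.
move=> t_reg /(Sd_tile_tiling_faces t_reg)[T_tiling _] uT.
have /and4P[ch c0 cov _] := face_tiling_full T_tiling uT.
apply/eqP; rewrite eqEcard cov /=.
have /andP[/eqP -> _] := t_reg; have /andP[/eqP <- _] := T_tiling.1 _ uT.
exact: chain_card_cover.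
Qed.

Lemma Sd_tiling_pure (R : realType) (V : finType) (n : nat) (T : {set tile V})
    (T' : {set tile {set V}}) :
  pure_tiles n T -> Sd_tiling R n T T' -> pure_tiles n T'.
Proof.
move=> [T_reg T_inj] [S [S_tiling ->]]; split.
  move=> u /finset.bigcupP[t tT uS].
  by have [[S_reg _] _] := Sd_tile_tiling_faces (T_reg _ tT) (S_tiling _ tT); apply: S_reg.
move=> u v /finset.bigcupP[t tT ut] /finset.bigcupP[t' tT' vt'] uv.
have ett' : t = t'.
  apply: T_inj => //; rewrite -(Sd_tile_cover (T_reg _ tT) (S_tiling _ tT) ut).
  by rewrite uv (Sd_tile_cover (T_reg _ tT') (S_tiling _ tT') vt').
have [/face_tiling_pure[_ S_inj] _] := Sd_tile_tiling_faces (T_reg _ tT) (S_tiling _ tT).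
by apply: S_inj => //; rewrite ett'.
Qed.

(** No tile is counted twice, because the tilings of distinct subdivided tiles
    have no simplex in common. *)
Lemma Sd_tiling_type_count (R : realType) (V : finType) (n s : nat)
    (T : {set tile V}) (T' : {set tile {set V}}) :
    pure_tiles n T -> Sd_tiling R n T T' -> (s <= n.+1)%N ->
  type_count T' s = (\sum_(t in T) ascent_count n #|t.2| s)%N.
Proof.
move=> [T_reg T_inj] [S [S_tiling ->]] sn.
(* Empty for t outside T, so that F is disjoint for all pairs of indices. *)
pose F t := finset (fun u => [&& t \in T, u \in S t & #|u.2| == s]).
have -> : type_count (\bigcup_(t in T) S t)%SET s = #|(\bigcup_t F t)%SET|.
  apply: eq_card => u; rewrite inE; apply/andP/finset.bigcupP.
    by move=> [/finset.bigcupP[t tT uS] us]; exists t; rewrite // inE tT uS us.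
  move=> [t _]; rewrite inE => /and3P[tT uS us]; split=> //.
  by apply/finset.bigcupP; exists t.
rewrite -sum1_card partition_disjoint_bigcup /= => [|t t' ntt'].
  rewrite [RHS]big_mkcond /=; apply: eq_bigr => t _; rewrite sum1_card.
  case: ifP => tT.
    rewrite -(Sd_tile_tiling_type_count (T_reg _ tT) (S_tiling _ tT) sn).
    by apply: eq_card => u; rewrite !inE tT.
  by apply/eqP; rewrite cards_eq0; apply/eqP/finset.setP => u; rewrite !inE tT.
rewrite -setI_eq0; apply/eqP/finset.setP => u; rewrite !inE.
apply/negP => /andP[/and3P[tT ut _] /and3P[tT' ut' _]]; case/eqP: ntt'.
apply: T_inj => //; rewrite -(Sd_tile_cover (T_reg _ tT) (S_tiling _ tT) ut).
by rewrite (Sd_tile_cover (T_reg _ tT') (S_tiling _ tT') ut').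
Qed.

Lemma h_vector_Sd_tiling (R : realType) (V : finType) (n : nat)
    (T : {set tile V}) (T' : {set tile {set V}}) :
    pure_tiles n T -> Sd_tiling R n T T' ->
  h_vector R n T' = (H_mx R n)^T *m h_vector R n T.
Proof.
move=> T_pure TT'; apply/colP => s.
rewrite h_vectorE (Sd_tiling_type_count T_pure TT'); last by rewrite -ltnS.
rewrite (sum_by_type (ascent_count n ^~ s) T_pure.1) natr_sum mxE.
apply: eq_bigr => k _.
by rewrite mxE H_mxE h_vectorE -natrM mulnC.
Qed.

(** * The normalized matrix and its stationary vector *)

Definition H_stoch (R : realType) (n : nat) : 'M[R]_n.+2 :=
  (n.+1)`!%:R^-1 *: H_mx R n.

Lemma H_stoch_ge0 (R : realType) n s k : 0 <= H_stoch R n s k.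
Proof. by rewrite mxE H_mxE mulr_ge0 ?invr_ge0. Qed.

Lemma fact_neq0 (R : realType) n : n`!%:R != 0 :> R.
Proof. by rewrite pnatr_eq0 -lt0n fact_gt0. Qed.

Lemma H_stoch_sum (R : realType) n s : \sum_k H_stoch R n s k = 1.
Proof.
under eq_bigr do rewrite mxE H_mxE.
by rewrite -mulr_sumr -natr_sum sum_ascent_count mulVf ?fact_neq0.
Qed.

Lemma H_stoch_col1 (R : realType) n s : (0 < n)%N ->
  (n.+1)`!%:R^-1 <= H_stoch R n s (inord 1).
Proof.
move=> n0; rewrite mxE H_mxE inordK // ler_peMr ?invr_ge0 // ler1n.
exact: ascent_count1_gt0.
Qed.

Lemma H_stoch_col0 (R : realType) n (s : 'I_n.+2) :
  H_stoch R n s ord0 = (n.+1)`!%:R^-1 *+ (s == ord0).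
Proof. by rewrite mxE H_mxE ascent_count0 mulr_natr. Qed.

Lemma H_stoch_rev (R : realType) n (s k : 'I_n.+2) :
  H_stoch R n (rev_ord s) (rev_ord k) = H_stoch R n s k.
Proof. by rewrite mxE [RHS]mxE !H_mxE /= !subSS ascent_count_sym // -ltnS. Qed.

Lemma fact_inv_gt0 (R : realType) n : 0 < n`!%:R^-1 :> R.
Proof. by rewrite invr_gt0 ltr0n fact_gt0. Qed.

Lemma H_eigenvectorE (R : realType) n (h : 'cV[R]_n.+2) :
  (H_mx R n)^T *m h = (n.+1)`!%:R *: h <-> h^T *m H_stoch R n = h^T.
Proof.
rewrite /H_stoch -scalemxAr; split=> [eig|/(congr1 trmx)].
  rewrite -[H_mx R n]trmxK -trmx_mul eig linearZ /= scalerA mulVf ?fact_neq0 //.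
  by rewrite scale1r.
rewrite linearZ /= trmx_mul trmxK => {2}<-.
by rewrite scalerA mulfV ?fact_neq0 // scale1r.
Qed.

Lemma h_lim_stationary (R : realType) n : (0 < n)%N ->
  (h_lim R n)^T *m H_stoch R n = (h_lim R n)^T /\ \sum_s h_lim R n s 0 = 1.
Proof.
move=> n0; have [p [pM p1]] := exists_stationary (@H_stoch_ge0 R n)
  (@H_stoch_sum R n) (fact_inv_gt0 R n.+1) (fun s => @H_stoch_col1 R n s n0).
suff [h_eig h1] : (H_mx R n)^T *m h_lim R n = (n.+1)`!%:R *: h_lim R n /\
    \sum_s h_lim R n s 0 = 1.
  by split=> //; apply/H_eigenvectorE.
apply: (@xgetPex _ 0 [set h : 'cV[R]_n.+2 |
  (H_mx R n)^T *m h = (n.+1)`!%:R *: h /\ \sum_s h s 0 = 1]).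
exists p^T; split.
  by apply/H_eigenvectorE; rewrite trmxK.
by rewrite -p1; apply: eq_bigr => s _; rewrite mxE.
Qed.

(** Reversing h^n gives another stationary vector of sum 1, as the matrix is invariant
    under simultaneous reversal of its rows and columns. *)
Lemma h_lim_rho (R : realType) n : (0 < n)%N -> rho (h_lim R n) = h_lim R n.
Proof.
move=> n0; have [hM h1] := h_lim_stationary R n0.
apply/eqP; rewrite -subr_eq0; apply/eqP/trmx_inj; rewrite trmx0.
apply: (stationary_zero (@H_stoch_ge0 R n) (@H_stoch_sum R n)
  (fact_inv_gt0 R n.+1) (fun s => @H_stoch_col1 R n s n0)).
  under eq_bigr do rewrite !mxE.
  rewrite sumrB h1 -h1 [X in _ - X](reindex_inj rev_ord_inj) /=.
  by rewrite subrr.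
rewrite linearB /= mulmxBl hM; congr (_ - _).
have rhoE k : (rho (h_lim R n))^T 0 k = (h_lim R n)^T 0 (rev_ord k) by rewrite !mxE.
apply/rowP => k; rewrite rhoE -[in RHS]hM mxE [RHS]mxE (reindex_inj rev_ord_inj) /=.
by apply: eq_bigr => s _; rewrite rhoE rev_ordK -H_stoch_rev rev_ordK.
Qed.

(** The only nonzero entry of column 0 is the first one, 1 / (n+1)!, which differs
    from 1 for n > 0. *)
Lemma h_lim_ord0 (R : realType) n : (0 < n)%N -> h_lim R n ord0 0 = 0.
Proof.
move=> n0; have [/rowP/(_ ord0) + _] := h_lim_stationary R n0.
rewrite mxE (bigD1 ord0) //= big1 ?addr0 => [|s s0]; last first.
  by rewrite H_stoch_col0 (negPf s0) mulr0n mulr0.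
rewrite H_stoch_col0 mulr1n mxE => /eqP; rewrite -subr_eq0 -[X in _ - X]mulr1 -mulrBr.
rewrite mulf_eq0 subr_eq0 => /orP[/eqP //|]; rewrite invr_eq1 pnatr_eq1.
by rewrite factS muln_eq1 eqSS gtn_eqF.
Qed.

Lemma h_vector_iterated (R : realType) (V : finType) (n : nat) (T : {set tile V})
    (TT : forall d : nat, {set tile (Sd_vertex d V)}) (d : nat) :
    pure_tiles n T -> iterated_Sd_tiling R n T TT ->
  h_vector R n (TT d) = ((H_mx R n)^T) ^+ d *m h_vector R n T.
Proof.
move=> T_pure [TT0 TTS].
have TT_pure k : pure_tiles n (TT k).
  by elim: k => [|k IHk]; [rewrite TT0 | exact: Sd_tiling_pure IHk (TTS k)].
elim: d => [|d IHd]; first by rewrite TT0 expr0 mul1mx.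
by rewrite (h_vector_Sd_tiling (TT_pure d) (TTS d)) IHd exprS mulmxA.
Qed.

Lemma h_totalE (R : realType) (V : finType) n (T : {set tile V}) :
  (forall t, t \in T -> regular_tile n t) -> h_total R n T = #|T|%:R.
Proof.
move=> T_reg; rewrite -sum1_card (sum_by_type (fun=> 1%N) T_reg) natr_sum.
by apply: eq_bigr => s _; rewrite h_vectorE muln1.
Qed.

(** Ensures that the normalization by the number of tiles is not a division by
    zero: the interior of any simplex of K meets a tile. *)
Lemma tiling_card_gt0 (R : realType) (V : finType) n (K : {set {set V}})
    (T : {set tile V}) :
    simplicial_complex K -> has_dimension n K -> tiling R n K T ->
  (0 < #|T|)%N.
Proof.
move=> [K0 _] Kdim T_tiling; rewrite card_gt0; apply/eqP => T0.
have [K_empty|/finset.set0Pn[s sK]] := eqVneq K finset.set0.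
  by move: Kdim; rewrite /has_dimension K_empty big_set0.
have s0 : s != finset.set0 by apply: contraNneq K0 => <-.
have [_ /(_ s s0)] := tiling_of_face_tiling (P := fun a => a \in K)
  (@realizationE R V K) T_tiling.
rewrite sK => /eqP/cards1P[t /finset.setP/(_ t)].
by rewrite !inE eqxx T0 inE.
Qed.

Lemma H_stoch_power (R : realType) n d :
  H_stoch R n ^+ d = ((n.+1)`! ^ d)%:R^-1 *: H_mx R n ^+ d.
Proof. by rewrite exprZn exprVn natrX. Qed.

Theorem corollary4p18 (R : realType) (n : nat) (hn : (0 < n)%N) :
  [/\ forall (V : finType) (K : {set {set V}}) (T : {set tile V})
        (TT : forall d : nat, {set tile (Sd_vertex d V)}),
        simplicial_complex K -> has_dimension n K -> tiling R n K T ->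
        iterated_Sd_tiling R n T TT ->
        (fun d : nat => (h_total R n T * ((n.+1)`! ^ d)%:R)^-1 *:
                        h_vector R n (TT d)) @ \oo --> h_lim R n,
      h_lim R n ord0 0 = 0 /\ h_lim R n ord_max 0 = 0,
      rho (h_lim R n) = h_lim R n &
      (fun d : nat => ((n.+1)`! ^ d)%:R^-1 *: (H_mx R n) ^+ d) @ \oo -->
        const_mx 1 *m (h_lim R n)^T].
Proof.
have [hM h1] := h_lim_stationary R hn.
have power_bound k (U : 'M[R]_(k, n.+2)) :
    (forall i, \sum_j U i j = 1) ->
    exists2 b : nat -> R, b @ \oo --> (0 : R) &
      forall d i j, `|h_lim R n j 0 - (U *m H_stoch R n ^+ d) i j| <= b d.
  move=> U1; have h1' : \sum_i (h_lim R n)^T 0 i = 1.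
    by rewrite -h1; apply: eq_bigr => i _; rewrite mxE.
  have [b b0 Ub] := stochastic_power_bound (@H_stoch_ge0 R n) (@H_stoch_sum R n)
    (fact_inv_gt0 R n.+1) (fun s => @H_stoch_col1 R n s hn) hM h1' U1.
  by exists b => // d i j; have := Ub d i j; rewrite [_^T _ _]mxE.
split.
- move=> V K T TT cK dK tK iT.
  have T_pure := realization_tiling_pure tK.
  have T_total := h_totalE R T_pure.1.
  have total_neq0 : h_total R n T != 0.
    by rewrite T_total pnatr_eq0 -lt0n (tiling_card_gt0 cK dK tK).
  pose U := (h_total R n T)^-1 *: (h_vector R n T)^T.
  have U1 i : \sum_j U i j = 1.
    under eq_bigr do rewrite mxE [_^T _ _]mxE.
    by rewrite (ord1 i) -mulr_sumr mulVf.
  have [b b0 Ub] := power_bound _ U U1.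
  apply: cvg_mx_le b0 => d i j; rewrite (ord1 j); apply: le_trans (Ub d 0 i).
  rewrite (h_vector_iterated d T_pure iT) H_stoch_power.
  have -> : U *m (((n.+1)`! ^ d)%:R^-1 *: H_mx R n ^+ d) =
      ((h_total R n T * ((n.+1)`! ^ d)%:R)^-1 *:
        ((H_mx R n)^T ^+ d *m h_vector R n T))^T.
    rewrite invfM -scalemxAl -scalemxAr scalerA linearZ /= trmx_mul; congr (_ *: (_ *m _)).
    by elim: d => [|d IHd]; rewrite ?expr0 ?trmx1 // exprS exprSr trmx_mul trmxK IHd.
  by rewrite [(_)^T _ _]mxE.
- split; first exact: h_lim_ord0.
  rewrite -h_lim_rho // mxE; have -> : rev_ord ord_max = ord0 :> 'I_n.+2.
    by apply: val_inj; rewrite /= subnn.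
  exact: h_lim_ord0.
- exact: h_lim_rho.
- have id1 (i : 'I_n.+2) : \sum_j (1%:M : 'M[R]_n.+2) i j = 1.
    rewrite (bigD1 i) //= mxE eqxx big1 ?addr0 // => j ji.
    by rewrite mxE eq_sym (negPf ji).
  have [b b0 Ub] := power_bound _ _ id1.
  apply: cvg_mx_le b0 => d i j; apply: le_trans (Ub d i j).
  rewrite mul1mx H_stoch_power [(const_mx 1 *m _) i j]mxE big_ord1.
  by rewrite [const_mx 1 _ _]mxE mul1r [_^T _ _]mxE.
Qed.
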